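(* Let $P=\frac12P_1+\frac12P_2$, where $P_1$ is the uniform distribution on $[0,1]$ and $P_2$ is the point mass at $\frac12$. Then $P$ has two different optimal sets of two-means.
   Context: For a Borel probability measure $Q$ on $\mathbb R$ with finite second moment and a finite nonempty set $\alpha\subset\mathbb R$, put $V(Q;\alpha)=\int\min_{a\in\alpha}(x-a)^2\,dQ(x)$ and $V_n(Q)=\inf\{V(Q;\alpha):\alpha\subset\mathbb R,\ 1\le\mathrm{card}(\alpha)\le n\}$. A set $\alpha$ with $1\le\mathrm{card}(\alpha)\le n$ is an optimal set of $n$-means for $Q$ if $V(Q;\alpha)=V_n(Q)$; ''two-means'' is the case $n=2$. *)

(* Defs.v *)
From HB Require Import structures.
From mathcomp Require Import all_boot all_order all_algebra finmap.
From mathcomp Require Import all_classical all_reals all_analysis.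

Set Implicit Arguments.
Unset Strict Implicit.
Unset Printing Implicit Defensive.

Import Order.TTheory GRing.Theory Num.Theory.
Import numFieldNormedType.Exports.

Local Open Scope classical_set_scope.
Local Open Scope ring_scope.

Section quantization.
Context {R : realType}.
Implicit Types (Q : probability (measurableTypeR R) R) (alpha : {fset R}).

(* The minimum is taken in \bar R so that +oo can serve as its neutral
   element; it is a real number as soon as alpha is nonempty. *)
Definition distortion Q alpha : \bar R :=
  (\int[Q]_x \big[Order.min/+oo]_(a <- alpha) ((x - a) ^+ 2)%:E)%E.

Definition admissible (n : nat) : set {fset R} :=
  [set alpha | (1 <= #|` alpha| <= n)%N].

Definition quantization_error (n : nat) Q : \bar R :=
  ereal_inf [set distortion Q alpha | alpha in admissible n].

Definition optimal_set_of_means (n : nat) Q alpha : Prop :=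
  admissible n alpha /\ distortion Q alpha = quantization_error n Q.

End quantization.

Section half_mixture.
Context {d : measure_display} {T : measurableType d} {R : realType}.
Variables P1 P2 : probability T R.

Definition half_mixture : set T -> \bar R :=
  measure_add (mscale (2^-1)%:nng P1) (mscale (2^-1)%:nng P2).

HB.instance Definition _ := Measure.copy half_mixture
  (measure_add (mscale (2^-1)%:nng P1) (mscale (2^-1)%:nng P2)).

Let half_mixture_setT : half_mixture setT = 1%E.
Proof.
rewrite /half_mixture measure_addE /= /mscale /= !probability_setT !mule1.
by rewrite -EFinD -[in LHS]div1r -splitr.
Qed.

HB.instance Definition _ :=
  Measure_isProbability.Build _ _ _ half_mixture half_mixture_setT.

End half_mixture.

Section mixed_distribution.
Context (R : realType).

Definition uniform01 : probability (measurableTypeR R) R :=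
  uniform_prob (@ltr01 R).

Definition point_mass_half : probability (measurableTypeR R) R :=
  \d_((2^-1 : R) : measurableTypeR R).

Definition mixed_distribution : probability (measurableTypeR R) R :=
  half_mixture uniform01 point_mass_half.

End mixed_distribution.

(* Main.v *)
(* A set of two points a <= b cuts the line at its midpoint c. If c >= 1/2, the
   atom 1/2 belongs to the cell of a, and twice the distortion is a function of
   a, b and m = min(c, 1) which, m being now regarded as independent of a and b,
   is a constant plus nonnegative multiples of three squares: one vanishes only
   at m = g, the positive root of g^2 + g = 1, the other two only when a and b
   are the conditional means of their cells. This leaves a = (3g - 1)/2 and
   b = (g + 1)/2, whose midpoint is indeed g. The case c <= 1/2 is the mirror
   image under x |-> 1 - x, so it yields a second, different, optimal set. *)
Require Import Defs.
From mathcomp Require Import all_boot all_order all_algebra finmap.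
From mathcomp Require Import all_classical all_reals all_analysis.
From mathcomp Require Import measurable_realfun ring lra.

Local Open Scope classical_set_scope.

Section two_means.
Set Implicit Arguments.
Unset Strict Implicit.
Import Order.TTheory GRing.Theory Num.Theory.
Import numFieldNormedType.Exports.
Local Open Scope ring_scope.

(** * Sets of at most two points *)

Lemma fset_card_le2 d (T : orderType d) (gamma : {fset T}) :
  (1 <= #|` gamma| <= 2)%N -> exists a b, (a <= b)%O /\ gamma = [fset a; b]%fset.
Proof.
case/andP; rewrite cardfs_gt0 => /fset0Pn[a ag].
rewrite (cardfsD1 a) ag add1n ltnS leq_eqVlt ltnS leqn0 => /orP[/cardfs1P[b eb]|].
  have -> : gamma = [fset a; b]%fset by rewrite -(fsetD1K ag) eb.
  have [ab|/ltW ba] := leP a b; first by exists a, b.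
  by exists b, a; split=> //; rewrite fsetUC.
rewrite cardfs_eq0 => /eqP e0.
by exists a, a; split=> //; rewrite -(fsetD1K ag) e0 fsetUid fsetU0.
Qed.

Lemma bigmin_fset2 (R : realType) (a b : R) (F : R -> \bar R) :
  \big[Order.min/+oo%E]_(x <- [fset a; b]%fset) F x = Order.min (F a) (F b).
Proof.
have [->|ab] := eqVneq a b.
  by rewrite fsetUid big_seq_fset1 minxx.
(* The order in which the set is enumerated is unknown. Length, distinctness and membership leave
   two orders, exchanged by commutativity of [min]. *)
have : uniq [fset a; b]%fset := fset_uniq _.
have : size [fset a; b]%fset = 2%N by rewrite -[LHS]/(#|` _|) cardfs2 ab.
have : forall x, (x \in enum_fset [fset a; b]%fset) = (x == a) || (x == b).
  by move=> x; rewrite -[LHS]/(x \in [fset a; b]%fset) !inE.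
case: (enum_fset _) => [|x [|y []]] //= xy _.
rewrite inE andbT => nxy; rewrite !big_cons big_nil miney.
have := xy x; have := xy y; rewrite !inE !eqxx orbT /=.
move=> /esym/orP[]/eqP ey /esym/orP[]/eqP ex; subst; rewrite ?eqxx in nxy => //.
by rewrite minC.
Qed.

(** * Integrals of squared distances *)

Lemma integral_sqrB_itv (R : realType) (a u v : R) : u <= v ->
  (\int[lebesgue_measure]_(x in `[u, v]) ((x - a) ^+ 2)%:E =
   (((v - a) ^+ 3 - (u - a) ^+ 3) / 3)%:E)%E.
Proof.
(* The degenerate interval does occur later: a cell of [0, 1] shrinks to a point when the midpoint
   lies outside ]0, 1[. *)
rewrite le_eqVlt => /orP[/eqP <-|uv].
  by rewrite set_itv1 integral_set1 subrr mul0r.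
have is_derive_continuous (f : R -> R) (x df : R) :
    is_derive x 1 f df -> {for x, continuous f}.
  move=> [fx _]; apply: differentiable_continuous.
  by apply/derivable1_diffP.
have df (x : R) : is_derive x 1 (fun y : R => (y - a) ^+ 2) (2 * (x - a)).
  by apply: is_derive_eq; rewrite /GRing.scale /=; ring.
have dF (x : R) : is_derive x 1 (fun y : R => (y - a) ^+ 3 / 3) ((x - a) ^+ 2).
  by apply: is_derive_eq; rewrite /GRing.scale /=; field.
rewrite (@continuous_FTC2 _ _ (fun y => (y - a) ^+ 3 / 3)) //.
- by rewrite -EFinB -mulrBl.
- by apply: continuous_subspaceT => x; apply: is_derive_continuous.
- split=> [x _||].
  + by have [] := dF x.
  + apply: cvg_at_right_filter; exact: is_derive_continuous (dF u).
  + apply: cvg_at_left_filter; exact: is_derive_continuous (dF v).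
- by move=> x _; rewrite derive1E; apply: derive_val.
Qed.

Section distortion.
Variable R : realType.
Implicit Types a b m x : R.

Definition nearest_sqr a b x : R := Num.min ((x - a) ^+ 2) ((x - b) ^+ 2).

Lemma nearest_sqr_ge0 a b x : 0 <= nearest_sqr a b x.
Proof. by rewrite /nearest_sqr le_min !sqr_ge0. Qed.

Lemma measurable_nearest_sqr a b (D : set R) :
  measurable_fun D (fun x => (nearest_sqr a b x)%:E).
Proof.
apply/measurable_EFinP; apply: measurable_minr; apply: measurable_funX;
  exact: measurable_funB.
Qed.

Lemma distortion_mixed a b :
  distortion (mixed_distribution R) [fset a; b]%fset =
  (2^-1%:E * \int[lebesgue_measure]_(x in `[0%R, 1%R]) (nearest_sqr a b x)%:E +
   2^-1%:E * (nearest_sqr a b 2^-1)%:E)%E.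
Proof.
rewrite /distortion.
under eq_integral do rewrite bigmin_fset2 -EFin_min -/(nearest_sqr a b _).
have mf : measurable_fun setT (fun x : measurableTypeR R => (nearest_sqr a b x)%:E).
  exact: measurable_nearest_sqr.
have f0 x : setT x -> (0 <= (nearest_sqr a b x)%:E)%E.
  by rewrite lee_fin nearest_sqr_ge0.
rewrite [LHS](ge0_integral_measure_add _ _ measurableT) //.
rewrite !(ge0_integral_mscale _ measurableT) //.
rewrite integral_uniform // => [|x]; last exact: f0.
rewrite subr0 invr1 mul1e.
by rewrite integral_dirac // diracT mul1e //.
Qed.

(** The integral is cut at [m], a null set. Excluding [m] from both hypotheses makes the first
    vacuous at [m = 0] and the second at [m = 1], as is needed when the midpoint of [a] and [b] lies
    outside [0, 1]. *)
Lemma integral_nearest_sqr a b m : 0 <= m <= 1 ->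
  {in `[0, m[, forall x, (x - a) ^+ 2 <= (x - b) ^+ 2} ->
  {in `]m, 1], forall x, (x - b) ^+ 2 <= (x - a) ^+ 2} ->
  (\int[lebesgue_measure]_(x in `[0%R, 1%R]) (nearest_sqr a b x)%:E =
   (((m - a) ^+ 3 + a ^+ 3) / 3 + ((1 - b) ^+ 3 - (m - b) ^+ 3) / 3)%:E)%E.
Proof.
case/andP=> m0 m1 na nb.
rewrite (@itv_bndbnd_setU _ _ _ (BRight m)) ?bnd_simp //.
rewrite ge0_integral_setU //; first last.
- apply/disj_setPS => x [] /=; rewrite !in_itv /= => /andP[_ xm] /andP[mx _].
  by move: xm; rewrite leNgt mx.
- by move=> x _; rewrite lee_fin nearest_sqr_ge0.
- exact: measurable_nearest_sqr.
rewrite (_ : a ^+ 3 = - (0 - a) ^+ 3); last by ring.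
have msqr (c : R) D : measurable_fun D (fun x : R => ((x - c) ^+ 2)%:E).
  by apply/measurable_EFinP; apply: measurable_funX; exact: measurable_funB.
rewrite EFinD -!integral_sqrB_itv //; congr (_ + _)%E.
  rewrite -[LHS]integral_itv_bndo_bndc; last exact: measurable_nearest_sqr.
  rewrite -[RHS]integral_itv_bndo_bndc; last exact: msqr.
  by apply: eq_integral => x; rewrite inE => /na xab; rewrite /nearest_sqr min_l.
rewrite -[RHS]integral_itv_obnd_cbnd; last exact: msqr.
by apply: eq_integral => x; rewrite inE => /nb xab; rewrite /nearest_sqr min_r.
Qed.

(* Twice the distortion when [0, m] (which contains 1/2) is quantized to [a]
   and [m, 1] to [b]. *)
Definition split_cost a b m : R :=
  ((m - a) ^+ 3 + a ^+ 3) / 3 + ((1 - b) ^+ 3 - (m - b) ^+ 3) / 3 +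
  (2^-1 - a) ^+ 2.

(** * The distortion of a pair as a split cost *)

Lemma sqrB_le_left a b x : a <= b -> x <= (a + b) / 2 ->
  (x - a) ^+ 2 <= (x - b) ^+ 2.
Proof.
move=> ab xm; rewrite -subr_ge0.
have -> : (x - b) ^+ 2 - (x - a) ^+ 2 = (b - a) * (a + b - 2 * x) by ring.
by apply: mulr_ge0; lra.
Qed.

Lemma sqrB_le_right a b x : a <= b -> (a + b) / 2 <= x ->
  (x - b) ^+ 2 <= (x - a) ^+ 2.
Proof.
move=> ab mx; rewrite -subr_ge0.
have -> : (x - a) ^+ 2 - (x - b) ^+ 2 = (b - a) * (2 * x - (a + b)) by ring.
by apply: mulr_ge0; lra.
Qed.

Lemma distortion_right a b : a <= b -> 1 <= a + b ->
  distortion (mixed_distribution R) [fset a; b]%fset =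
  (2^-1 * split_cost a b (Num.min ((a + b) / 2) 1))%:E.
Proof.
move=> ab ab1; set m := Num.min _ _.
have [mc m1] : m <= (a + b) / 2 /\ m <= 1.
  by split; rewrite /m ge_min lexx ?orbT.
have m12 : 2^-1 <= m by rewrite /m le_min; apply/andP; split; lra.
rewrite distortion_mixed (@integral_nearest_sqr _ _ m); first last.
- move=> x; rewrite in_itv /= => /andP[mx x1]; apply: sqrB_le_right => //.
  by move: mx; rewrite /m gt_min => /orP[/ltW//|]; lra.
- by move=> x; rewrite in_itv /= => /andP[x0 xm]; apply: sqrB_le_left => //; lra.
- by apply/andP; split; lra.
have -> : nearest_sqr a b 2^-1 = (2^-1 - a) ^+ 2.
  by rewrite /nearest_sqr min_l // sqrB_le_left //; lra.
by rewrite -!EFinM -EFinD -mulrDr.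
Qed.

(** The reflected pair [1 - b], [1 - a] has sum at least 1. The measure is not transported: the
    integral is cut at [1 - m], and the resulting polynomial is identified with the reflected split
    cost. *)
Lemma distortion_left a b : a <= b -> a + b <= 1 ->
  distortion (mixed_distribution R) [fset a; b]%fset =
  (2^-1 * split_cost (1 - b) (1 - a) (Num.min (((1 - b) + (1 - a)) / 2) 1))%:E.
Proof.
move=> ab ab1; set m := Num.min _ _.
have [mc m1] : m <= ((1 - b) + (1 - a)) / 2 /\ m <= 1.
  by split; rewrite /m ge_min lexx ?orbT.
have m12 : 2^-1 <= m by rewrite /m le_min; apply/andP; split; lra.
rewrite distortion_mixed (@integral_nearest_sqr _ _ (1 - m)); first last.
- move=> x; rewrite in_itv /= => /andP[mx x1].
  by apply: sqrB_le_right => //; lra.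
- move=> x; rewrite in_itv /= => /andP[x0 xm]; apply: sqrB_le_left => //.
  have : m < 1 - x by lra.
  by rewrite /m gt_min => /orP[|]; lra.
- by apply/andP; split; lra.
have -> : nearest_sqr a b 2^-1 = (2^-1 - b) ^+ 2.
  by rewrite /nearest_sqr min_r // sqrB_le_right //; lra.
rewrite -!EFinM -EFinD; congr (_%:E).
by rewrite /split_cost; field.
Qed.

(** * Minimizing the split cost; the optimal split point is the reciprocal of the golden ratio *)

Definition golden : R := (Num.sqrt 5 - 1) / 2.

Lemma golden_sqr : golden ^+ 2 = 1 - golden.
Proof.
have : Num.sqrt 5 ^+ 2 = 5 :> R by rewrite sqr_sqrtr.
by rewrite /golden; set s := Num.sqrt _ => s5; field: s5.
Qed.

Lemma golden_bounds : 2^-1 < golden < 1.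
Proof.
have s5 : Num.sqrt 5 ^+ 2 = 5 :> R by rewrite sqr_sqrtr.
have s0 : 0 <= Num.sqrt 5 :> R by rewrite sqrtr_ge0.
by apply/andP; rewrite /golden; split; nra.
Qed.

(* The last two terms are the costs of a and b missing the conditional means of
   their cells; the first is the excess, over its minimum, of the cost of the
   best means for the split point m. *)
Lemma split_cost_squares a b m : 0 <= m ->
  split_cost a b m = (19 - 30 * golden) / 12 +
    ((m - golden) ^+ 2 * (m + 2 * golden - 1) / (2 * (m + 1)) +
     (m + 1) * (a - (m ^+ 2 + 1) / (2 * (m + 1))) ^+ 2 +
     (1 - m) * (b - (m + 1) / 2) ^+ 2).
Proof.
move=> m0; have m1 : m + 1 != 0 by rewrite gt_eqF //; lra.
(* Completing the squares in [a] and [b] leaves [(6 m^3 - 6 m^2 + m + 1) / (12 (m + 1))].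
   Subtracting its value at [golden] leaves a cubic numerator with double root [golden] and third
   root [1 - 2 * golden]. *)
have g2 := golden_sqr; rewrite /split_cost.
by field: g2.
Qed.

Lemma split_cost_min a b m : 2^-1 <= m <= 1 ->
  (19 - 30 * golden) / 12 <= split_cost a b m ?= iff
  [&& m == golden, a == (3 * golden - 1) / 2 & b == (golden + 1) / 2].
Proof.
case/andP=> m12 m1; have /andP[g12 g1] := golden_bounds.
rewrite split_cost_squares; last by lra.
set s1 := _ / (2 * (m + 1)); set s2 := (m + 1) * _; set s3 := (1 - m) * _.
have c1 : 0 < (m + 2 * golden - 1) / (2 * (m + 1)) by apply: divr_gt0; lra.
have s1E : s1 = (m - golden) ^+ 2 * ((m + 2 * golden - 1) / (2 * (m + 1))).
  by rewrite /s1 mulrA.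
have s10 : 0 <= s1 by rewrite s1E mulr_ge0 ?sqr_ge0 // ltW.
have s20 : 0 <= s2 by rewrite mulr_ge0 ?sqr_ge0 //; lra.
have s30 : 0 <= s3 by rewrite mulr_ge0 ?sqr_ge0 //; lra.
split; first by lra.
have -> : ((19 - 30 * golden) / 12 == (19 - 30 * golden) / 12 + (s1 + s2 + s3)) =
          [&& s1 == 0, s2 == 0 & s3 == 0].
  apply/eqP/and3P => [e|[/eqP -> /eqP -> /eqP ->]]; last by rewrite !addr0.
  by split; apply/eqP; lra.
rewrite s1E mulf_eq0 sqrf_eq0 subr_eq0 (gt_eqF c1) orbF.
(* The coefficient [1 - m] vanishes at [m = 1], so [b] is determined only once [m = golden] is
   known. *)
case: eqVneq => //= mg.
rewrite /s2 /s3 (mulf_eq0 (m + 1)) (mulf_eq0 (1 - m)) !sqrf_eq0 !subr_eq0 mg.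
rewrite [golden + 1 == 0]gt_eqF ?[1 == golden]gt_eqF //=; last by lra.
(* The conditional mean [(g^2 + 1) / (2 (g + 1))] equals [(3 g - 1) / 2] because [g^2 = 1 - g]. *)
congr ((_ == _) && _); rewrite golden_sqr.
have g2 := golden_sqr; have gn0 : golden + 1 != 0 by rewrite gt_eqF //; lra.
by field: g2.
Qed.

Definition left_mean : R := (3 * golden - 1) / 2.
Definition right_mean : R := (golden + 1) / 2.

(** Tying [m] back to [a] and [b] keeps the minimum attained, since the midpoint of the two optimal
    means is [golden] itself. *)
Lemma split_cost_mid_min a b : 1 <= a + b ->
  (19 - 30 * golden) / 12 <= split_cost a b (Num.min ((a + b) / 2) 1)
    ?= iff (a == left_mean) && (b == right_mean).
Proof.
move=> ab1; have /andP[g12 g1] := golden_bounds.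
set m := Num.min _ _.
have /(split_cost_min a b) : 2^-1 <= m <= 1.
  rewrite /m ge_min lexx orbT andbT le_min.
  by apply/andP; split; lra.
have [/eqP a0|] := boolP (a == left_mean); last by rewrite andbF.
have [/eqP b0|] := boolP (b == right_mean); last by rewrite !andbF.
have -> : m = golden; last by rewrite eqxx.
rewrite /m a0 b0 /left_mean /right_mean min_l; [by field|lra].
Qed.

(** * The two optimal sets *)

Lemma distortion_min a b : a <= b ->
  ((2^-1 * ((19 - 30 * golden) / 12))%:E <=
     distortion (mixed_distribution R) [fset a; b]%fset)%E /\
  (distortion (mixed_distribution R) [fset a; b]%fset =
     (2^-1 * ((19 - 30 * golden) / 12))%:E ->
   [fset a; b]%fset = [fset left_mean; right_mean]%fset \/
   [fset a; b]%fset = [fset 1 - right_mean; 1 - left_mean]%fset).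
Proof.
have half_neq0 : 2^-1 != 0 :> R by rewrite gt_eqF.
move=> ab; have [ab1|/ltW ab1] := leP 1 (a + b).
  have [lb eqlb] := split_cost_mid_min ab1; rewrite distortion_right //.
  rewrite lee_fin ler_pM2l //; split=> // -[] /(mulfI half_neq0) e; left.
  move: eqlb; rewrite e eqxx.
  by move=> /esym/andP[/eqP -> /eqP ->].
have ab1' : 1 <= (1 - b) + (1 - a) by lra.
have [lb eqlb] := split_cost_mid_min ab1'; rewrite distortion_left //.
rewrite lee_fin ler_pM2l //; split=> // -[] /(mulfI half_neq0) e; right.
move: eqlb; rewrite e eqxx.
by move=> /esym/andP[/eqP <- /eqP <-]; rewrite !subKr.
Qed.

Lemma distortion_means :
  distortion (mixed_distribution R) [fset left_mean; right_mean]%fset =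
  (2^-1 * ((19 - 30 * golden) / 12))%:E.
Proof.
have /andP[g12 g1] := golden_bounds.
have lr : 1 <= left_mean + right_mean by rewrite /left_mean /right_mean; lra.
rewrite distortion_right //; last by rewrite /left_mean /right_mean; lra.
by have [_] := split_cost_mid_min lr; rewrite !eqxx => /eqP <-.
Qed.

Lemma distortion_means_reflected :
  distortion (mixed_distribution R) [fset 1 - right_mean; 1 - left_mean]%fset =
  (2^-1 * ((19 - 30 * golden) / 12))%:E.
Proof.
have /andP[g12 g1] := golden_bounds.
have lr : 1 <= left_mean + right_mean by rewrite /left_mean /right_mean; lra.
rewrite distortion_left; [|rewrite /left_mean /right_mean; lra..].
rewrite !subKr; by have [_] := split_cost_mid_min lr; rewrite !eqxx => /eqP <-.
Qed.

Lemma admissible_fset2 a b : admissible 2 [fset a; b]%fset.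
Proof. by rewrite /admissible /= cardfs2; case: (a != b). Qed.

Lemma quantization_error2 :
  quantization_error 2 (mixed_distribution R) =
  (2^-1 * ((19 - 30 * golden) / 12))%:E.
Proof.
apply/eqP; rewrite eq_le; apply/andP; split.
  rewrite -distortion_means; apply: ereal_inf_lbound.
  by exists [fset left_mean; right_mean]%fset => //; exact: admissible_fset2.
apply: le_ereal_inf_tmp => _ [gamma /fset_card_le2[a [b [ab ->]]] <-].
by have [] := distortion_min ab.
Qed.

Lemma optimal_two_means :
  [set gamma | optimal_set_of_means 2 (mixed_distribution R) gamma] =
  [set [fset left_mean; right_mean]%fset;
       [fset 1 - right_mean; 1 - left_mean]%fset].
Proof.
apply/seteqP; split=> [gamma [/fset_card_le2[a [b [ab ->]]]]|gamma].
  by rewrite quantization_error2; have [_] := distortion_min ab.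
rewrite /= /optimal_set_of_means quantization_error2 => -[] ->; split;
  by [exact: admissible_fset2 | exact: distortion_means
     | exact: distortion_means_reflected].
Qed.

Lemma means_neq_reflected :
  [fset left_mean; right_mean]%fset <> [fset 1 - right_mean; 1 - left_mean]%fset.
Proof.
have /andP[g12 g1] := golden_bounds.
(* As [golden > 1/2], [right_mean] exceeds 3/4 while both reflected points lie below 3/4. *)
move=> e; have : right_mean \in [fset 1 - right_mean; 1 - left_mean]%fset.
  by rewrite -e !inE eqxx orbT.
by rewrite !inE /right_mean /left_mean => /orP[]/eqP; lra.
Qed.

End distortion.

End two_means.

Theorem proposition3p4 (R : realType) :
  exists alpha beta : {fset R},
    alpha <> beta /\
    [set gamma : {fset R} | optimal_set_of_means 2 (mixed_distribution R) gamma]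
      = [set alpha; beta].
Proof.
do 2!eexists; split; last exact: optimal_two_means.
exact: means_neq_reflected.
Qed.
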